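(* Let $a\in\mathbb{C}$ with $|a|<1$. For every $f\in C(\mathbb{T})$ and every $n=0,1,2,\dots$, $$\|\sigma_n^a(f)\|_\infty\le\|f\|_\infty .$$
   Context: $\mathbb{T}=\mathbb{R}/2\pi\mathbb{Z}$; functions on $\mathbb{T}$ are real- or complex-valued and identified with $2\pi$-periodic functions on $\mathbb{R}$; $C(\mathbb{T})$ is the space of continuous ones and $\|\cdot\|_\infty$ the (essential) supremum norm. For $a=|a|e^{it_a}$, $|a|<1$, the nonlinear phase function $\theta_a:\mathbb{R}\to\mathbb{R}$ is the continuous function with $e^{i\theta_a(t)}=\dfrac{e^{it}-a}{1-\overline{a}e^{it}}$ (a fixed choice of continuous branch). It is strictly increasing, satisfies $\theta_a(t+2\pi)=\theta_a(t)+2\pi$, and has derivative the Poisson kernel $\theta_a'(t)=p_a(t)=\dfrac{1-|a|^2}{1-2|a|\cos(t-t_a)+|a|^2}$. For $f\in L^1(\mathbb{T})$, $c_k(f)=\dfrac1{2\pi}\displaystyle\int_{-\pi}^{\pi}f(t)e^{-ik\theta_a(t)}p_a(t)\,dt$ for $k\in\mathbb{Z}$, $S_n^a(f)(x)=\displaystyle\sum_{k=-n}^{n}c_k(f)e^{ik\theta_a(x)}$, and the $n$-th Fejér (Cesàro) mean is $\sigma_n^a(f)(x)=\dfrac1{n+1}\displaystyle\sum_{k=0}^{n}S_k^a(f)(x)$. *)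

(* Defs.v *)
(* Stdlib real numbers with Coquelicot. *)
From Stdlib Require Import Reals ZArith.
From Coquelicot Require Import Coquelicot.
Open Scope R_scope.

(* e^{it} for real t; Coquelicot has no complex exponential. *)
Definition cis (t : R) : C := (cos t, sin t).

(* Functions on T = R / 2 pi Z are 2 pi-periodic functions on R; real-valued
   ones are included through the embedding of R in C. *)
Definition continuous_on_torus (f : R -> C) : Prop :=
  (forall t : R, f (t + 2 * PI) = f t) /\ (forall t : R, continuous f t).

(* [theta] is determined by [a] up to an additive constant in 2 pi Z. *)
Definition nonlinear_phase (a : C) (theta : R -> R) : Prop :=
  (forall t : R, continuous theta t) /\
  (forall t : R,
     cis (theta t) = ((cis t - a) / (1 - Cconj a * cis t))%C).

(* [ta] is an argument of [a] (arbitrary when a = 0). *)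
Definition poisson_kernel (a : C) (ta t : R) : R :=
  (1 - Cmod a ^ 2) / (1 - 2 * Cmod a * cos (t - ta) + Cmod a ^ 2).

(* The integral is the Riemann integral, which is the Lebesgue integral for the
   continuous functions considered here.  The instance is given explicitly
   since the default one makes C a module over itself, not over R. *)
Definition coef (a : C) (ta : R) (theta : R -> R) (f : R -> C) (k : Z) : C :=
  (RtoC (/ (2 * PI)) *
   RInt (V := C_R_CompleteNormedModule)
     (fun t => (f t * cis (- (IZR k * theta t))
                * RtoC (poisson_kernel a ta t))%C) (- PI) PI)%C.

(* The index k = j - n runs over -n, ..., n as j runs over 0, ..., 2n. *)
Definition partial_sum (a : C) (ta : R) (theta : R -> R) (f : R -> C) (n : nat)
    (x : R) : C :=
  sum_n (fun j : nat =>
           let k := (Z.of_nat j - Z.of_nat n)%Z in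
           (coef a ta theta f k * cis (IZR k * theta x))%C) (2 * n).

Definition fejer_mean (a : C) (ta : R) (theta : R -> R) (f : R -> C) (n : nat)
    (x : R) : C :=
  (RtoC (/ INR (n + 1)) *
   sum_n (fun k : nat => partial_sum a ta theta f k x) n)%C.

(* The essential supremum of a continuous function is its supremum. *)
Definition sup_norm (f : R -> C) : Rbar :=
  Lub_Rbar (fun r : R => exists t : R, r = Cmod (f t)).

(* Main.v *)
Require Import Defs.
From Stdlib Require Import Reals ZArith Lia Lra.
From Coquelicot Require Import Coquelicot.
Open Scope R_scope.

(** The mean [fejer_mean f n x] is an average of [f]: summing the coefficient
    integrals under the integral sign writes it as the integral over
    [-PI, PI] of [f t] against the weight
      [/ (2 * PI) * poisson_kernel a ta t * fejer_kernel n (theta x - theta t)]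
    ([fejer_mean_is_RInt]).  The weight is nonnegative, because the sum of the
    first Dirichlet kernels is the square [|1 + z + ... + z^n|^2] with
    [z = e^{iy}] ([sum_dirichlet]), and because the Poisson kernel is positive.
    Its total mass is [1] ([fejer_weight_mass]).  The bound is then the
    triangle inequality for integrals.

    The mass is the Fejer mean of the constant function [1], so it suffices
    that [coef 1 k] is [1] for [k = 0] and [0] otherwise ([coef_one]).  The
    coefficients see [theta] only through [cis theta], so [theta] may be
    replaced by any other function with the same [cis].  Write
    [u = t - ta], [r = |a|] and [w = 1 - r e^{iu}]; then
    [(e^{it} - a) / (1 - conj a e^{it}) = e^{it} conj w / w], and since
    [Re w > 0] the explicit function
      [t + 2 atan (r sin u / (1 - r cos u))]
    is a smooth branch of its argument ([cis_phase_lift]).  Its derivative is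
    the Poisson kernel and it grows by [2 PI] over a period, so [coef 1 k]
    becomes, by substitution, the integral of [e^{-iky} / (2 PI)] over an
    interval of length [2 PI]. *)

(* Sums in C are typed in its abelian monoid structure, which [ring] does not
   recognize as C. *)
Ltac ring_C := match goal with |- @eq _ ?l ?r => change (@eq C l r) end; ring.

(** * The unit circle *)

Lemma cis_plus (x y : R) : cis (x + y) = (cis x * cis y)%C.
Proof.
  unfold cis, Cmult; simpl; rewrite cos_plus, sin_plus; f_equal; ring.
Qed.

Lemma cis_opp (x : R) : cis (- x) = Cconj (cis x).
Proof. unfold cis, Cconj; simpl; now rewrite cos_neg, sin_antisym. Qed.

Lemma cis_0 : cis 0 = 1%C.
Proof. unfold cis; now rewrite cos_0, sin_0. Qed.

Lemma cis_mult_conj (x : R) : (cis x * Cconj (cis x) = 1)%C.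
Proof. now rewrite <- cis_opp, <- cis_plus, Rplus_opp_r, cis_0. Qed.

Lemma cis_INR_mult (k : nat) (x : R) : cis (INR k * x) = (cis x ^ k)%C.
Proof.
  induction k as [|k IHk].
  - now rewrite Rmult_0_l, cis_0.
  - rewrite S_INR, Rmult_plus_distr_r, Rmult_1_l, cis_plus, IHk; simpl; ring.
Qed.

Lemma cis_IZR_sub_mult (j k : nat) (x : R) :
  cis (IZR (Z.of_nat j - Z.of_nat k) * x) = (cis x ^ j * Cconj (cis x) ^ k)%C.
Proof.
  rewrite minus_IZR, <- !INR_IZR_INZ.
  replace ((INR j - INR k) * x) with (INR j * x + - (INR k * x)) by ring.
  now rewrite cis_plus, cis_opp, !cis_INR_mult, Cpow_conj.
Qed.

(** This is what lets one branch of a phase be exchanged for another inside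
    the coefficients. *)
Lemma cis_eq_IZR_mult (x y : R) (k : Z) :
  cis x = cis y -> cis (IZR k * x) = cis (IZR k * y).
Proof.
  intros H.
  replace k with (Z.of_nat (Z.to_nat k) - Z.of_nat (Z.to_nat (- k)))%Z by lia.
  now rewrite !cis_IZR_sub_mult, H.
Qed.

Lemma cis_period (x : R) (k : Z) : cis (IZR k * (x + 2 * PI)) = cis (IZR k * x).
Proof.
  apply cis_eq_IZR_mult; unfold cis; rewrite cos_plus, sin_plus, cos_2PI, sin_2PI;
    f_equal; ring.
Qed.

(** * Nonnegativity of the Fejer kernel *)

Definition geom (z : C) (n : nat) : C := sum_n (fun j : nat => (z ^ j)%C) n.

Lemma geom_S (z : C) (n : nat) : geom z (S n) = (geom z n + z ^ S n)%C.
Proof. unfold geom; now rewrite sum_Sn. Qed.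

Lemma geom_0 (z : C) : geom z 0 = 1%C.
Proof. unfold geom; now rewrite sum_O. Qed.

Lemma geom_split (z : C) (m p : nat) :
  geom z (m + S p) = (geom z m + z ^ S m * geom z p)%C.
Proof.
  induction p as [|p IHp].
  - rewrite Nat.add_1_r, geom_S, geom_0; ring.
  - rewrite Nat.add_succ_r, geom_S, IHp, geom_S.
    replace (S (m + S p))%nat with (S m + S p)%nat by lia.
    rewrite Cpow_add_r; ring.
Qed.

(** Conjugation on the unit circle reverses the order of the terms, up to the
    factor [z ^ n]. *)
Lemma geom_conj (z : C) (n : nat) :
  (z * Cconj z = 1 -> Cconj (geom z n) = Cconj z ^ n * geom z n)%C.
Proof.
  intros Hz; induction n as [|n IHn].
  - rewrite geom_0; simpl; unfold Cconj, Cmult, RtoC; simpl; f_equal; ring.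
  - assert (Hs := geom_split z 0 n); rewrite Nat.add_0_l, geom_0, Cpow_1_r in Hs.
    rewrite Hs.
    replace (Cconj z ^ S n * (1 + z * geom z n))%C
      with (Cconj z ^ S n + (z * Cconj z) * (Cconj z ^ n * geom z n))%C
      by (simpl; ring).
    rewrite Hz, <- IHn, <- Hs, geom_S, Cplus_conj, Cpow_conj; ring.
Qed.

(** The [k]-th summand is the Dirichlet kernel, the sum of [z ^ m] over
    [-k <= m <= k].  Passing from [n] to [n + 1] in [|geom z n|^2] adds
    [1 + z^(n+1) conj (geom z n) + conj (z^(n+1) conj (geom z n))], whose terms
    are exactly the powers of [z] of index between [-(n+1)] and [n+1]. *)
Lemma sum_dirichlet (z : C) (n : nat) :
  (z * Cconj z = 1)%C ->
  sum_n (fun k : nat => sum_n (fun j : nat => (z ^ j * Cconj z ^ k)%C) (2 * k)) n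
  = RtoC (Cmod (geom z n) ^ 2).
Proof.
  intros Hz.
  assert (Hd : forall k, sum_n (fun j : nat => (z ^ j * Cconj z ^ k)%C) (2 * k)
                 = (geom z (2 * k) * Cconj z ^ k)%C).
  { intros k; apply (sum_n_mult_r (K := C_Ring)). }
  rewrite (sum_n_ext _ _ n Hd), Cmod2_conj, (geom_conj z n Hz); clear Hd.
  induction n as [|n IHn].
  - rewrite sum_O; cbn [Nat.mul Cpow]; now rewrite !geom_0, !Cmult_1_r.
  - rewrite sum_Sn, IHn; change plus with Cplus.
    replace (2 * S n)%nat with (n + S (S n))%nat by lia.
    rewrite (geom_split z n (S n)).
    assert (Hs := geom_split z 0 n); rewrite Nat.add_0_l, geom_0, geom_S in Hs.
    assert (Hp : (z ^ n * Cconj z ^ n = 1)%C)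
      by now rewrite <- Cpow_mult_l, Hz, Cpow_1_l.
    rewrite geom_S; cbn [Cpow] in *; rewrite Cmult_1_r in Hs.
    (* What remains is polynomial in [G], [z], [w], [u], [v], modulo
       [z w = 1], [u v = 1] and [G + z u = 1 + z G]. *)
    set (G := geom z n) in *; set (w := Cconj z) in *.
    set (u := (z ^ n)%C) in *; set (v := (w ^ n)%C) in *.
    transitivity (v * G * G + w * v * G + (z * w) * (u * v) * (G + z * u))%C; [ring_C|].
    transitivity (w * v * G + (z * w) * (u * v)
                  + (z * w) * (v * G * G + z * (u * v) * G))%C.
    { rewrite Hz, Hp, !Cmult_1_l, Cmult_1_r, Hs; ring_C. }
    transitivity ((G + z * u) * (w * v * (1 + z * G)))%C; [ring_C|].
    now rewrite <- Hs.
Qed.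

(** * An explicit branch of the phase *)

(** An argument of the Blaschke factor, as [e^{it} conj w / w] with
    [w = 1 - r e^{i(t - ta)}] in the right half-plane; the quotient under
    [atan] is minus the slope of [w]. *)
Definition phase_lift (r ta t : R) : R :=
  t + 2 * atan (r * sin (t - ta) / (1 - r * cos (t - ta))).

Lemma one_minus_r_cos_pos (r u : R) : 0 <= r < 1 -> 0 < 1 - r * cos u.
Proof. intros Hr; assert (H := COS_bound u); nra. Qed.

Lemma poisson_denom_pos (r u : R) : 0 <= r < 1 -> 0 < 1 - 2 * r * cos u + r ^ 2.
Proof. intros Hr; assert (H := COS_bound u); nra. Qed.

(** With [u = t - ta] the derivative is
    [1 + 2 (r cos u - r^2) / (1 - 2 r cos u + r^2)], which is the Poisson
    kernel. *)
Lemma is_derive_phase_lift (a : C) (ta t : R) :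
  Cmod a < 1 -> is_derive (phase_lift (Cmod a) ta) t (poisson_kernel a ta t).
Proof.
  intros Ha; unfold phase_lift, poisson_kernel.
  assert (H0 := Cmod_ge_0 a).
  set (r := Cmod a) in *.
  assert (Hp := one_minus_r_cos_pos r (t - ta) (conj H0 Ha)).
  assert (Hq := poisson_denom_pos r (t - ta) (conj H0 Ha)).
  auto_derive.
  - unfold Rminus in Hp; lra.
  - change (t + - ta) with (t - ta).
    assert (Hsc := sin2_cos2 (t - ta)); unfold Rsqr in Hsc.
    set (s := sin (t - ta)) in *; set (c := cos (t - ta)) in *.
    assert (Hs : s ^ 2 = 1 - c ^ 2) by lra.
    replace (1 + - (r * c)) with (1 - r * c) by ring.
    set (x := 1 - r * c) in *; set (d := 1 - 2 * r * c + r ^ 2) in *.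
    assert (E : 1 + r * s * / x * (r * s * / x * 1) = d / x ^ 2).
    { replace d with (x ^ 2 + r ^ 2 * s ^ 2) by (unfold d, x; rewrite Hs; ring).
      field; lra. }
    rewrite E.
    transitivity ((d + 2 * (r * c * x - r ^ 2 * s ^ 2)) / d); [field; lra|].
    rewrite Hs; unfold x, d; f_equal; ring.
Qed.

Lemma cis_double_atan_div (x y : R) :
  0 < x -> cis (2 * atan (y / x)) = ((x, y) / Cconj (x, y))%C.
Proof.
  intros Hx.
  assert (Hq : 0 < 1 + (y / x)²) by (assert (H := Rle_0_sqr (y / x)); lra).
  assert (Hxy : x * x + y * y <> 0) by nra.
  assert (E : 1 + (y / x)² = (x * x + y * y) / (x * x)) by (unfold Rsqr; field; lra).
  assert (Hss := sqrt_sqrt _ (Rlt_le _ _ Hq)).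
  assert (Hs := sqrt_lt_R0 _ Hq).
  unfold cis; rewrite cos_2a, sin_2a, cos_atan, sin_atan.
  set (q := sqrt (1 + (y / x)²)) in *.
  unfold Cdiv, Cmult, Cinv, Cconj; simpl; f_equal.
  - transitivity ((1 - (y / x) * (y / x)) / (q * q)); [field; lra|].
    rewrite Hss, E; field; repeat split; nra.
  - transitivity ((2 * (y / x)) / (q * q)); [field; lra|].
    rewrite Hss, E; field; repeat split; nra.
Qed.

Lemma cis_phase_lift (a : C) (ta t : R) :
  Cmod a < 1 -> a = (RtoC (Cmod a) * cis ta)%C ->
  cis (phase_lift (Cmod a) ta t) = ((cis t - a) / (1 - Cconj a * cis t))%C.
Proof.
  intros Ha Hta; unfold phase_lift.
  assert (H0 := Cmod_ge_0 a).
  set (r := Cmod a) in *.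
  assert (Hp := one_minus_r_cos_pos r (t - ta) (conj H0 Ha)).
  assert (Ht : cis t = (cis ta * cis (t - ta))%C) by (rewrite <- cis_plus; f_equal; ring).
  rewrite cis_plus, cis_double_atan_div by exact Hp.
  set (u := t - ta) in *.
  replace (Cconj (1 - r * cos u, r * sin u)) with (1 - RtoC r * cis u)%C
    by (unfold cis, Cconj, Cminus, Cplus, Copp, Cmult, RtoC; simpl; f_equal; ring).
  replace (1 - r * cos u, r * sin u) with (1 - RtoC r * Cconj (cis u))%C
    by (unfold cis, Cconj, Cminus, Cplus, Copp, Cmult, RtoC; simpl; f_equal; ring).
  unfold Cdiv; rewrite Cmult_assoc; f_equal; [|f_equal].
  - rewrite Hta, Ht.
    transitivity (cis ta * (cis u - r * (cis u * Cconj (cis u))))%C; [ring|].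
    rewrite cis_mult_conj; ring.
  - replace (Cconj a) with (RtoC r * Cconj (cis ta))%C
      by (rewrite Hta, Cmult_conj; f_equal; unfold Cconj, RtoC; simpl; f_equal; ring).
    rewrite Ht.
    transitivity (1 - r * ((cis ta * Cconj (cis ta)) * cis u))%C; [|ring].
    rewrite cis_mult_conj; ring.
Qed.

Lemma phase_lift_period (r ta : R) :
  phase_lift r ta PI = phase_lift r ta (- PI) + 2 * PI.
Proof.
  unfold phase_lift.
  replace (PI - ta) with (- PI - ta + 2 * PI) by ring.
  rewrite cos_plus, sin_plus, cos_2PI, sin_2PI.
  rewrite !Rmult_0_r, !Rmult_1_r, Rminus_0_r, Rplus_0_r; ring.
Qed.

(** * Continuity and integration of complex-valued functions *)

Lemma norm_C_R (z : C) : @norm R_AbsRing C_R_NormedModule z = Cmod z.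
Proof.
  change (sqrt (Rabs (fst z) ^ 2 + Rabs (snd z) ^ 2) = Cmod z).
  now rewrite !pow2_abs.
Qed.

Lemma continuous_C_pair (u v : R -> R) (t : R) :
  continuous u t -> continuous v t -> continuous (fun s => (u s, v s) : C) t.
Proof.
  intros Hu Hv.
  apply (continuous_comp_2 (U := R_UniformSpace) (V := R_UniformSpace)
           (W := R_UniformSpace) (X := C_UniformSpace) u v (fun x y => (x, y)) t Hu Hv).
  apply (continuous_ext (fun z : R * R => z)); [now intros [x y]|].
  apply continuous_id.
Qed.

Lemma continuous_Cmult (f g : R -> C) (t : R) :
  continuous f t -> continuous g t -> continuous (fun s => f s * g s)%C t.
Proof.
  intros Hf Hg.
  assert (Hf1 := continuous_comp f fst t Hf (continuous_fst _ _)).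
  assert (Hf2 := continuous_comp f snd t Hf (continuous_snd _ _)).
  assert (Hg1 := continuous_comp g fst t Hg (continuous_fst _ _)).
  assert (Hg2 := continuous_comp g snd t Hg (continuous_snd _ _)).
  apply continuous_C_pair.
  - apply (continuous_minus (V := R_NormedModule));
      now apply (continuous_mult (K := R_AbsRing)).
  - apply (continuous_plus (V := R_NormedModule));
      now apply (continuous_mult (K := R_AbsRing)).
Qed.

Lemma continuous_RtoC (u : R -> R) (t : R) :
  continuous u t -> continuous (fun s => RtoC (u s)) t.
Proof. intros Hu; apply continuous_C_pair; [exact Hu | apply continuous_const]. Qed.

Lemma continuous_cis (u : R -> R) (t : R) :
  continuous u t -> continuous (fun s => cis (u s)) t.
Proof.
  intros Hu; apply continuous_C_pair;
    apply (continuous_comp u); auto; [apply continuous_cos | apply continuous_sin].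
Qed.

Lemma continuous_poisson_kernel (a : C) (ta t : R) :
  Cmod a < 1 -> continuous (poisson_kernel a ta) t.
Proof.
  intros Ha; apply (ex_derive_continuous (V := R_NormedModule)).
  unfold poisson_kernel; auto_derive.
  assert (H := poisson_denom_pos (Cmod a) (t - ta) (conj (Cmod_ge_0 a) Ha)).
  unfold Rminus in H; lra.
Qed.

Lemma poisson_kernel_pos (a : C) (ta t : R) : Cmod a < 1 -> 0 < poisson_kernel a ta t.
Proof.
  intros Ha; assert (H0 := Cmod_ge_0 a).
  apply Rdiv_lt_0_compat; [nra|].
  now apply poisson_denom_pos.
Qed.

(** Complex scalars are not the scalars of C as a real normed module, so
    linearity over them is obtained componentwise. *)
Lemma is_RInt_C_Cmult (f : R -> C) (a b : R) (l c : C) :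
  is_RInt (V := C_R_NormedModule) f a b l ->
  is_RInt (V := C_R_NormedModule) (fun t => c * f t)%C a b (c * l)%C.
Proof.
  intros H.
  assert (H1 := is_RInt_fct_extend_fst f a b l H).
  assert (H2 := is_RInt_fct_extend_snd f a b l H).
  apply (is_RInt_fct_extend_pair (U := R_NormedModule) (V := R_NormedModule)).
  - apply (is_RInt_minus (V := R_NormedModule));
      now apply (is_RInt_scal (V := R_NormedModule)).
  - apply (is_RInt_plus (V := R_NormedModule));
      now apply (is_RInt_scal (V := R_NormedModule)).
Qed.

Lemma is_RInt_C_sum_n (f : nat -> R -> C) (l : nat -> C) (a b : R) (n : nat) :
  (forall k, is_RInt (V := C_R_NormedModule) (f k) a b (l k)) ->
  is_RInt (V := C_R_NormedModule) (fun t => sum_n (fun k => f k t) n) a b (sum_n l n).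
Proof.
  intros H; induction n as [|n IHn].
  - rewrite sum_O; eapply is_RInt_ext; [|apply (H 0%nat)].
    intros t _; now rewrite sum_O.
  - rewrite sum_Sn; eapply is_RInt_ext; [|apply (is_RInt_plus _ _ _ _ _ _ IHn (H (S n)))].
    intros t _; now rewrite sum_Sn.
Qed.

(** * The Fejer kernel and the integral form of the means *)

Definition fejer_kernel (n : nat) (y : R) : R :=
  / INR (n + 1) * Cmod (geom (cis y) n) ^ 2.

Lemma fejer_kernel_ge_0 (n : nat) (y : R) : 0 <= fejer_kernel n y.
Proof.
  apply Rmult_le_pos; [|apply pow2_ge_0].
  apply Rlt_le, Rinv_0_lt_compat, lt_0_INR; lia.
Qed.

Lemma fejer_kernel_sum (n : nat) (y : R) :
  RtoC (fejer_kernel n y) =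
  (RtoC (/ INR (n + 1)) *
   sum_n (fun k : nat => sum_n (fun j : nat =>
     cis (IZR (Z.of_nat j - Z.of_nat k) * y)) (2 * k)) n)%C.
Proof.
  unfold fejer_kernel; rewrite RtoC_mult, <- (sum_dirichlet (cis y) n (cis_mult_conj y)).
  f_equal; apply sum_n_ext; intros k; apply sum_n_ext; intros j.
  now rewrite cis_IZR_sub_mult.
Qed.

Lemma coef_is_RInt (a : C) (ta : R) (theta : R -> R) (f : R -> C) (k : Z) :
  Cmod a < 1 -> (forall t, continuous theta t) -> (forall t, continuous f t) ->
  is_RInt (V := C_R_NormedModule)
    (fun t => f t * RtoC (/ (2 * PI) * poisson_kernel a ta t)
              * cis (- (IZR k * theta t)))%C
    (- PI) PI (coef a ta theta f k).
Proof.
  intros Ha Htheta Hf.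
  assert (Hint : ex_RInt (V := C_R_CompleteNormedModule)
    (fun t => (f t * cis (- (IZR k * theta t)) * RtoC (poisson_kernel a ta t))%C)
    (- PI) PI).
  { apply (ex_RInt_continuous (V := C_R_CompleteNormedModule)); intros t _.
    repeat apply continuous_Cmult.
    - apply Hf.
    - apply continuous_cis, (continuous_opp (V := R_NormedModule)).
      apply (continuous_mult (K := R_AbsRing)); [apply continuous_const | apply Htheta].
    - now apply continuous_RtoC, continuous_poisson_kernel. }
  eapply is_RInt_ext;
    [|apply (is_RInt_C_Cmult _ _ _ _ (RtoC (/ (2 * PI))) (RInt_correct _ _ _ Hint))].
  intros t _; cbv beta; rewrite RtoC_mult.
  ring_C.
Qed.

(** The weight does not depend on [f], so the same formula applied to the
    constant function [1] computes its mass. *)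
Lemma fejer_mean_is_RInt (a : C) (ta : R) (theta : R -> R) (f : R -> C)
    (n : nat) (x : R) :
  Cmod a < 1 -> (forall t, continuous theta t) -> (forall t, continuous f t) ->
  is_RInt (V := C_R_NormedModule)
    (fun t => f t * RtoC (/ (2 * PI) * poisson_kernel a ta t
                          * fejer_kernel n (theta x - theta t)))%C
    (- PI) PI (fejer_mean a ta theta f n x).
Proof.
  intros Ha Htheta Hf; unfold fejer_mean, partial_sum.
  eapply is_RInt_ext;
    [|apply is_RInt_C_Cmult, is_RInt_C_sum_n; intros k;
      apply is_RInt_C_sum_n; intros j; rewrite Cmult_comm;
      apply is_RInt_C_Cmult, coef_is_RInt; assumption].
  intros t _; cbv beta zeta.
  rewrite (RtoC_mult _ (fejer_kernel n (theta x - theta t))), fejer_kernel_sum.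
  set (g := (f t * RtoC (/ (2 * PI) * poisson_kernel a ta t))%C).
  transitivity (RtoC (/ INR (n + 1)) * (g *
    sum_n (fun k : nat => sum_n (fun j : nat =>
     cis (IZR (Z.of_nat j - Z.of_nat k) * (theta x - theta t))) (2 * k)) n))%C.
  - f_equal; rewrite <- (sum_n_mult_l (K := C_Ring)).
    apply sum_n_ext; intros k; rewrite <- (sum_n_mult_l (K := C_Ring)).
    apply sum_n_ext; intros j.
    replace (IZR (Z.of_nat j - Z.of_nat k) * (theta x - theta t))
      with (IZR (Z.of_nat j - Z.of_nat k) * theta x
            + - (IZR (Z.of_nat j - Z.of_nat k) * theta t)) by ring.
    rewrite cis_plus; change mult with Cmult; ring_C.
  - unfold g; ring_C.
Qed.

(** * Total mass of the weight *)

(** Substitution [y = phase_lift t]. *)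
Lemma is_RInt_phase_lift (a : C) (ta : R) (G g : R -> R) :
  Cmod a < 1 ->
  (forall y, is_derive G y (g y)) -> (forall y, continuous g y) ->
  is_RInt (fun t => g (phase_lift (Cmod a) ta t) * poisson_kernel a ta t) (- PI) PI
    (G (phase_lift (Cmod a) ta (- PI) + 2 * PI) - G (phase_lift (Cmod a) ta (- PI))).
Proof.
  intros Ha HG Hg; rewrite <- phase_lift_period.
  set (lift := phase_lift (Cmod a) ta).
  assert (Hd : forall t, is_derive lift t (poisson_kernel a ta t))
    by (intros t; now apply is_derive_phase_lift).
  apply (is_RInt_derive (V := R_CompleteNormedModule) (fun t => G (lift t)));
    intros t _.
  - rewrite Rmult_comm; apply (is_derive_comp G lift); [apply HG | apply Hd].
  - apply (continuous_mult (K := R_AbsRing));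
      [|now apply continuous_poisson_kernel].
    apply (continuous_comp lift g); [|apply Hg].
    apply (ex_derive_continuous (V := R_NormedModule)); eexists; apply Hd.
Qed.

(** With [theta] replaced by [phase_lift], the real and imaginary parts are
    integrated by substitution.  For [k <> 0] their primitives are periodic in
    the phase, so the boundary terms cancel; for [k = 0] the real part has
    primitive [phase_lift] itself, which grows by [2 * PI]. *)
Lemma coef_one (a : C) (ta : R) (theta : R -> R) (k : Z) :
  Cmod a < 1 -> a = (RtoC (Cmod a) * cis ta)%C -> nonlinear_phase a theta ->
  coef a ta theta (fun _ => 1%C) k = if Z.eqb k 0 then 1%C else 0%C.
Proof.
  intros Ha Hta [_ Htheta]; unfold coef.
  set (lift := phase_lift (Cmod a) ta).
  assert (Hi : forall t, cis (IZR k * theta t) = cis (IZR k * lift t)).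
  { intros t; apply cis_eq_IZR_mult; rewrite Htheta; symmetry; now apply cis_phase_lift. }
  assert (HR : is_RInt (V := C_R_NormedModule)
     (fun t => RtoC 1 * cis (- (IZR k * theta t)) * RtoC (poisson_kernel a ta t))%C
     (- PI) PI ((if Z.eqb k 0 then RtoC (2 * PI) else RtoC 0) : C)).
  { apply (is_RInt_ext (V := C_R_NormedModule)
             (fun t => (cos (IZR k * lift t) * poisson_kernel a ta t,
                        - sin (IZR k * lift t) * poisson_kernel a ta t))).
    { intros t _; rewrite cis_opp, Hi; unfold cis, Cconj, Cmult, RtoC; simpl.
      f_equal; ring. }
    assert (Hcc : forall y, continuous (fun s => cos (IZR k * s)) y)
      by (intros y; apply (ex_derive_continuous (V := R_NormedModule)); now auto_derive).
    assert (Hcs : forall y, continuous (fun s => - sin (IZR k * s)) y)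
      by (intros y; apply (ex_derive_continuous (V := R_NormedModule)); now auto_derive).
    destruct (Z.eqb_spec k 0) as [->|Hk].
    - apply (is_RInt_fct_extend_pair (U := R_NormedModule) (V := R_NormedModule)).
      + evar_last.
        * apply (is_RInt_phase_lift a ta (fun y => y) _ Ha) with (2 := Hcc).
          intros y; auto_derive; [easy|]; rewrite Rmult_0_l, cos_0; reflexivity.
        * simpl; ring.
      + evar_last.
        * apply (is_RInt_phase_lift a ta (fun _ => 0) _ Ha) with (2 := Hcs).
          intros y; auto_derive; [easy|]; rewrite Rmult_0_l, sin_0; ring.
        * simpl; ring.
    - assert (Hk' : IZR k <> 0) by now apply not_0_IZR.
      assert (Hend := cis_period (lift (- PI)) k).
      injection Hend as Hcos Hsin.
      apply (is_RInt_fct_extend_pair (U := R_NormedModule) (V := R_NormedModule)).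
      + evar_last.
        * apply (is_RInt_phase_lift a ta (fun y => sin (IZR k * y) / IZR k) _ Ha)
            with (2 := Hcc).
          intros y; auto_derive; [easy|]; field; exact Hk'.
        * fold lift; cbv beta; rewrite Hsin; simpl; ring.
      + evar_last.
        * apply (is_RInt_phase_lift a ta (fun y => cos (IZR k * y) / IZR k) _ Ha)
            with (2 := Hcs).
          intros y; auto_derive; [easy|]; field; exact Hk'.
        * fold lift; cbv beta; rewrite Hcos; simpl; ring. }
  rewrite (is_RInt_unique (V := C_R_CompleteNormedModule) _ _ _ _ HR).
  destruct (Z.eqb k 0); [|ring].
  rewrite <- RtoC_mult, Rinv_l; [easy|]. assert (H := PI_RGT_0); lra.
Qed.

Lemma sum_n_indicator (u : nat -> C) (m n : nat) :
  (m <= n)%nat ->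
  sum_n (fun j => if Nat.eqb j m then u j else RtoC 0) n = u m.
Proof.
  intros Hmn.
  assert (Hz : forall p, (p < m)%nat ->
            sum_n (fun j => if Nat.eqb j m then u j else RtoC 0) p = RtoC 0).
  { induction p as [|p IHp]; intros Hp.
    - rewrite sum_O; now destruct (Nat.eqb_spec 0 m); [lia|].
    - rewrite sum_Sn, IHp by lia; destruct (Nat.eqb_spec (S p) m); [lia|].
      apply Cplus_0_l. }
  induction Hmn as [|n Hmn IHn].
  - destruct m as [|m]; [now rewrite sum_O|].
    rewrite sum_Sn, Hz, Nat.eqb_refl by lia; apply Cplus_0_l.
  - rewrite sum_Sn, IHn; destruct (Nat.eqb_spec (S n) m); [lia|]; apply Cplus_0_r.
Qed.

Lemma fejer_mean_one (a : C) (ta : R) (theta : R -> R) (n : nat) (x : R) :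
  Cmod a < 1 -> a = (RtoC (Cmod a) * cis ta)%C -> nonlinear_phase a theta ->
  fejer_mean a ta theta (fun _ => 1%C) n x = 1%C.
Proof.
  intros Ha Hta Htheta; unfold fejer_mean.
  rewrite (sum_n_ext _ (fun _ => RtoC 1)).
  - assert (Hs : forall m, sum_n (fun _ => RtoC 1) m = RtoC (INR (m + 1))).
    { induction m as [|m IHm]; [now rewrite sum_O|].
      rewrite sum_Sn, IHm; change plus with Cplus.
      replace (S m + 1)%nat with (S (m + 1)) by lia; now rewrite S_INR, RtoC_plus. }
    rewrite Hs, <- RtoC_mult, Rinv_l; [easy | apply not_0_INR; lia].
  - intros k; unfold partial_sum.
    rewrite (sum_n_ext _ (fun j => if Nat.eqb j k then RtoC 1 else RtoC 0)).
    + apply (sum_n_indicator (fun _ => RtoC 1)); lia.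
    + intros j; cbv zeta; rewrite coef_one by assumption.
      destruct (Nat.eqb_spec j k) as [->|Hjk].
      * rewrite Z.sub_diag, Rmult_0_l, cis_0; apply Cmult_1_l.
      * destruct (Z.eqb_spec (Z.of_nat j - Z.of_nat k) 0); [lia | apply Cmult_0_l].
Qed.

(** The mass of the weight is the Fejer mean of the function [1], written as an
    integral. *)
Lemma fejer_weight_mass (a : C) (ta : R) (theta : R -> R) (n : nat) (x : R) :
  Cmod a < 1 -> a = (RtoC (Cmod a) * cis ta)%C -> nonlinear_phase a theta ->
  is_RInt (fun t => / (2 * PI) * poisson_kernel a ta t
                    * fejer_kernel n (theta x - theta t)) (- PI) PI 1.
Proof.
  intros Ha Hta Htheta.
  assert (H := fejer_mean_is_RInt a ta theta (fun _ => 1%C) n x Ha (proj1 Htheta)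
                 (fun t => continuous_const _ _)).
  rewrite fejer_mean_one in H by assumption.
  apply (is_RInt_fct_extend_fst (U := R_NormedModule) (V := R_NormedModule)) in H.
  eapply is_RInt_ext; [|exact H].
  intros t _; exact (f_equal fst (Cmult_1_l (RtoC _))).
Qed.

(** * The sup-norm bound *)

Lemma Cmod_fejer_mean_le (a : C) (ta : R) (theta : R -> R) (f : R -> C)
    (n : nat) (x M : R) :
  Cmod a < 1 -> a = (RtoC (Cmod a) * cis ta)%C -> nonlinear_phase a theta ->
  (forall t, continuous f t) -> (forall t, Cmod (f t) <= M) ->
  Cmod (fejer_mean a ta theta f n x) <= M.
Proof.
  intros Ha Hta Htheta Hf HM; rewrite <- norm_C_R.
  assert (HPI := PI_RGT_0).
  rewrite <- (Rmult_1_r M).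
  apply (norm_RInt_le (V := C_R_NormedModule) _ _ (- PI) PI _ _ ltac:(lra))
    with (2 := fejer_mean_is_RInt a ta theta f n x Ha (proj1 Htheta) Hf)
         (3 := is_RInt_scal _ _ _ M _ (fejer_weight_mass a ta theta n x Ha Hta Htheta)).
  intros t _; rewrite norm_C_R, Cmod_mult, Cmod_R.
  assert (Hw : 0 <= / (2 * PI) * poisson_kernel a ta t
                    * fejer_kernel n (theta x - theta t)).
  { apply Rmult_le_pos; [|apply fejer_kernel_ge_0].
    apply Rmult_le_pos; [|now apply Rlt_le, poisson_kernel_pos].
    apply Rlt_le, Rinv_0_lt_compat; lra. }
  rewrite Rabs_pos_eq by exact Hw.
  exact (Rmult_le_compat_r _ _ _ Hw (HM t)).
Qed.

Theorem theorem7 (a : C) (ta : R) (theta : R -> R)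
    (ha : Cmod a < 1)
    (hta : a = (RtoC (Cmod a) * cis ta)%C)
    (htheta : nonlinear_phase a theta)
    (f : R -> C) (hf : continuous_on_torus f) (n : nat) :
  Rbar_le (sup_norm (fejer_mean a ta theta f n)) (sup_norm f).
Proof.
  destruct (Lub_Rbar_correct (fun r => exists t, r = Cmod (f t))) as [Hub _].
  apply Lub_Rbar_correct; intros r [x ->]; fold (sup_norm f) in Hub.
  assert (Hle : forall t, Rbar_le (Cmod (f t)) (sup_norm f))
    by (intros t; apply Hub; now exists t).
  (* An infinite supremum leaves nothing to prove, and it is not [m_infty]
     because the torus is not empty. *)
  destruct (sup_norm f) as [M| |]; [| exact I | exact (Hle 0)].
  apply Cmod_fejer_mean_le; auto; apply hf.
Qed.
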